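(* For every $n\ge 2$ and every orientation $\bar G$ of the type $B_n$ Coxeter diagram, the type $B$ Cambrian lattice $C(\bar G)$ is trim. Equivalently, the set $\mathcal B$ of signed permutations in $B_n$ avoiding the patterns $\bar 231$ and $31\underline 2$, ordered by weak order, is a trim lattice.
   Context: $B_n$ is the group of signed permutations: bijections $\pi$ of $\{-n,\dots,-1,1,\dots,n\}$ with $\pi(-i)=-\pi(i)$, written in one-line notation $\pi_{-n}\cdots\pi_{-1}\pi_1\cdots\pi_n$ with $\pi_i=\pi(i)$. The inversion set $I(\pi)$ is a set of positive roots: for $0<i<j$, $e_j-e_i\in I(\pi)$ iff $j$ precedes $i$ in the one-line notation; $e_i\in I(\pi)$ iff $i$ precedes $-i$; $e_j+e_i\in I(\pi)$ (for $i\neq j$) iff $i$ precedes $-j$. Weak order: $\pi\le\sigma$ iff $I(\pi)\subseteq I(\sigma)$; it is a lattice. The Coxeter diagram is a path $s_0,s_1,\dots,s_{n-1}$; an orientation $\bar G$ chooses for each $1\le i\le n-1$ either $s_{i-1}\to s_i$ or $s_{i-1}\leftarrow s_i$. Define complementary subsets $D,U$ of $\{-n+1,\dots,-1,1,\dots,n-1\}$: if $s_{i-1}\to s_i$ then $i\in D$ and $-i\in U$; if $s_{i-1}\leftarrow s_i$ then $i\in U$ and $-i\in D$. A signed permutation $\pi$ contains $\bar 231$ if there are positions $p<q<r$ in $\{-n,\dots,-1,1,\dots,n\}$ (ordered as integers) with $\pi_r<\pi_p<\pi_q$ and $\pi_p\in U$; it contains $31\underline 2$ if there are positions $p<q<r$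 with $\pi_q<\pi_r<\pi_p$ and $\pi_r\in D$. By a result of Reading, $\mathcal B$ is a sublattice of weak order on $B_n$ isomorphic to the Cambrian lattice $C(\bar G)$ (a lattice quotient of weak order whose fibres have minimal elements exactly $\mathcal B$). A finite lattice is trim if, for some $m$, it has a maximal chain of $m+1$ left modular elements (an element $x$ is left modular if $(y\vee x)\wedge z=y\vee(x\wedge z)$ for all $y<z$) and has exactly $m$ join-irreducibles and exactly $m$ meet-irreducibles. *)

(* Defs.v *)
From HB Require Import structures.
From mathcomp Require Import all_boot all_order all_algebra all_fingroup.

Set Implicit Arguments.
Unset Strict Implicit.
Unset Printing Implicit Defensive.

Import Order.TTheory GRing.Theory Num.Theory.
Local Open Scope ring_scope.

(* (false, k) stands for the integer k + 1 and (true, k) for -(k + 1), so that *)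
(* sgn n is {-n, ..., -1, 1, ..., n}; positions and values are compared via    *)
(* their integer value.                                                        *)
Definition sgn (n : nat) := (bool * 'I_n)%type.

Definition ival (n : nat) (x : sgn n) : int :=
  if x.1 then - (x.2.+1)%:Z else (x.2.+1)%:Z.

Definition sopp (n : nat) (x : sgn n) : sgn n := (~~ x.1, x.2).
Definition spos (n : nat) (i : 'I_n) : sgn n := (false, i).
Definition sneg (n : nat) (i : 'I_n) : sgn n := (true, i).

Lemma ivalN (n : nat) (x : sgn n) : ival (sopp x) = - ival x.
Proof. by case: x => [[] k] //=; rewrite /ival /= opprK. Qed.

Lemma ival_inj (n : nat) : injective (@ival n).
Proof.
move=> [[] i] [[] j]; rewrite /ival //=.
- by move/oppr_inj => -[] /val_inj ->.
- by case => /val_inj ->.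
Qed.

Definition is_signed (n : nat) (p : {perm sgn n}) : bool :=
  [forall x, p (sopp x) == sopp (p x)].

Record sperm (n : nat) : predArgType :=
  SPerm { sperm_val :> {perm sgn n}; sperm_signed : is_signed sperm_val }.

HB.instance Definition _ n := [isSub for @sperm_val n].
HB.instance Definition _ n := [Finite of sperm n by <:].

(* x occurs to the left of y in the one-line notation of p. *)
Definition precedes (n : nat) (p : sperm n) (x y : sgn n) : bool :=
  ival ((sperm_val p)^-1%g x) < ival ((sperm_val p)^-1%g y).

Definition basis (n : nat) (i : 'I_n) : 'rV[int]_n := delta_mx 0 i.

Definition inversions (n : nat) (p : sperm n) : seq 'rV[int]_n :=
  [seq basis ij.2 - basis ij.1 | ij : 'I_n * 'I_n
     in [pred ij : 'I_n * 'I_n | (ij.1 < ij.2)%N && precedes p (spos ij.2) (spos ij.1)]] ++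
  [seq basis i | i : 'I_n in [pred i : 'I_n | precedes p (spos i) (sneg i)]] ++
  [seq basis ij.2 + basis ij.1 | ij : 'I_n * 'I_n
     in [pred ij : 'I_n * 'I_n | (ij.1 != ij.2) && precedes p (spos ij.1) (sneg ij.2)]].

Definition weak_le (n : nat) (p q : sperm n) : bool :=
  all [in inversions q] (inversions p).

Lemma weak_leP (n : nat) (p q : sperm n) :
  reflect {subset inversions p <= inversions q} (weak_le p q).
Proof. exact: allP. Qed.

Lemma sperm_invN (n : nat) (p : sperm n) (x : sgn n) :
  (sperm_val p)^-1%g (sopp x) = sopp ((sperm_val p)^-1%g x).
Proof.
apply: (@perm_inj _ (sperm_val p)); rewrite permKV.
by move/forallP: (sperm_signed p) => /(_ ((sperm_val p)^-1%g x)) /eqP ->; rewrite permKV.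
Qed.

Lemma precedesN (n : nat) (p : sperm n) (x y : sgn n) :
  precedes p (sopp x) (sopp y) = precedes p y x.
Proof. by rewrite /precedes !sperm_invN !ivalN ltrN2. Qed.

Lemma precedesC (n : nat) (p : sperm n) (x y : sgn n) :
  x != y -> precedes p y x = ~~ precedes p x y.
Proof.
move=> nxy; rewrite /precedes -leNgt le_eqVlt; case: eqP => //= /ival_inj.
by move/perm_inj=> e; rewrite e eqxx in nxy.
Qed.

Definition coord_sum (n : nat) (v : 'rV[int]_n) : int := \sum_i v 0 i.

Lemma coord_sumD (n : nat) (u v : 'rV[int]_n) :
  coord_sum (u + v) = coord_sum u + coord_sum v.
Proof. by rewrite -big_split; apply: eq_bigr => i _; rewrite mxE. Qed.

Lemma coord_sumN (n : nat) (u : 'rV[int]_n) : coord_sum (- u) = - coord_sum u.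
Proof. by rewrite -sumrN; apply: eq_bigr => i _; rewrite mxE. Qed.

Lemma coord_sum_basis (n : nat) (i : 'I_n) : coord_sum (basis i) = 1.
Proof.
rewrite /coord_sum (bigD1 i) //= big1 => [|j /negPf nij]; rewrite mxE ?eqxx //=.
by rewrite nij.
Qed.

Lemma basis_inj (n : nat) : injective (@basis n).
Proof.
move=> i j /matrixP/(_ 0 i); rewrite !mxE !eqxx /=.
by case: eqP.
Qed.

Lemma basisB_inj (n : nat) (i j k l : 'I_n) : i != j ->
  basis j - basis i = basis l - basis k -> (i = k) /\ (j = l).
Proof.
move=> nij E; move/matrixP: (E) => /(_ 0 i); move/matrixP: (E) => /(_ 0 j).
rewrite !mxE !eqxx /= (negPf nij) eq_sym (negPf nij) /=.
by case: (j =P l); case: (j =P k); case: (i =P k); case: (i =P l).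
Qed.

Lemma basisD_inj (n : nat) (i j k l : 'I_n) : i != j ->
  basis j + basis i = basis l + basis k ->
  (i = k /\ j = l) \/ (i = l /\ j = k).
Proof.
move=> nij E; move/matrixP: (E) => /(_ 0 i); move/matrixP: (E) => /(_ 0 j).
rewrite !mxE !eqxx /= (negPf nij) eq_sym (negPf nij) /=.
case: (j =P l) => jl; case: (j =P k) => jk; case: (i =P k) => ik;
  case: (i =P l) => il /=; try by [left | right].
  by case/eqP: nij; rewrite il jl.
by case/eqP: nij; rewrite ik jk.
Qed.

Lemma mem_inversionsB (n : nat) (p : sperm n) (i j : 'I_n) : (i < j)%N ->
  (basis j - basis i \in inversions p) = precedes p (spos j) (spos i).
Proof.
move=> ij; rewrite !mem_cat; apply/idP/idP => [|H].
- case/or3P=> /imageP [].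
  + move=> [k l] /= /andP[_ H] E.
    by have [|-> ->] := basisB_inj _ E; first by rewrite -val_eqE ltn_eqF.
  + move=> k _ /(congr1 (@coord_sum n)).
    by rewrite coord_sumD coord_sumN !coord_sum_basis.
  + move=> [k l] _ /(congr1 (@coord_sum n)).
    by rewrite !coord_sumD coord_sumN !coord_sum_basis.
- by apply/or3P/Or31/imageP; exists (i, j) => //; rewrite inE /= ij.
Qed.

Lemma mem_inversions1 (n : nat) (p : sperm n) (i : 'I_n) :
  (basis i \in inversions p) = precedes p (spos i) (sneg i).
Proof.
rewrite !mem_cat; apply/idP/idP => [|H].
- case/or3P=> /imageP [].
  + move=> [k l] _ /(congr1 (@coord_sum n)).
    by rewrite !coord_sumD coord_sumN !coord_sum_basis.
  + by move=> k H /basis_inj ->.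
  + move=> [k l] _ /(congr1 (@coord_sum n)).
    by rewrite !coord_sumD !coord_sum_basis.
- by apply/or3P/Or32/imageP; exists i.
Qed.

Lemma mem_inversionsD (n : nat) (p : sperm n) (i j : 'I_n) : i != j ->
  (basis j + basis i \in inversions p) = precedes p (spos i) (sneg j).
Proof.
move=> ij; rewrite !mem_cat; apply/idP/idP => [|H].
- case/or3P=> /imageP [].
  + move=> [k l] _ /(congr1 (@coord_sum n)).
    by rewrite !coord_sumD coord_sumN !coord_sum_basis.
  + move=> k _ /(congr1 (@coord_sum n)).
    by rewrite !coord_sumD !coord_sum_basis.
  + move=> [k l] /= /andP[_ H] /(basisD_inj ij) [] [-> ->] //.
    by rewrite -precedesN.
- by apply/or3P/Or33/imageP; exists (i, j) => //; rewrite inE /= ij.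
Qed.

Lemma precedes_ext (n : nat) (p q : sperm n) : inversions p =i inversions q ->
  forall x y, precedes p x y = precedes q x y.
Proof.
move=> E.
have HB (i j : 'I_n) : (i < j)%N ->
    precedes p (spos j) (spos i) = precedes q (spos j) (spos i).
  by move=> ij; rewrite -!mem_inversionsB.
have Hpos (i j : 'I_n) :
    precedes p (spos j) (spos i) = precedes q (spos j) (spos i).
  case: (ltngtP i j) => [/HB // | ji | /val_inj ->]; last by rewrite /precedes !ltxx.
  have nij : spos i != spos j.
    by apply/eqP => -[] e; rewrite e ltnn in ji.
  by rewrite (precedesC p nij) (precedesC q nij) HB.
have Hpn (i j : 'I_n) :
    precedes p (spos i) (sneg j) = precedes q (spos i) (sneg j).
  case: (eqVneq i j) => [->|nij]; first by rewrite -!mem_inversions1.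
  by rewrite -!mem_inversionsD.
move=> [[] i] [[] j].
- by have := Hpos i j; rewrite -precedesN -[RHS]precedesN.
- have ne : spos j != sneg i by [].
  by rewrite (precedesC p ne) (precedesC q ne) Hpn.
- exact: Hpn.
- exact: Hpos.
Qed.

Lemma card_ival_lt_inj (n : nat) :
  injective (fun x : sgn n => #|[set y : sgn n | ival y < ival x]|).
Proof.
suff H (x y : sgn n) : ival x < ival y ->
    (#|[set z : sgn n | (ival z < ival x)%R]| <
     #|[set z : sgn n | (ival z < ival y)%R]|)%N.
  move=> x y /= E; apply: ival_inj.
  by case: (ltgtP (ival x) (ival y)) => // /H; rewrite E ltnn.
move=> xy; apply: proper_card; apply/properP; split.
  by apply/subsetP => z; rewrite !inE  => zx; exact: lt_trans zx xy.
by exists x; rewrite !inE ?ltxx.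
Qed.

Lemma inversions_inj (n : nat) (p q : sperm n) :
  inversions p =i inversions q -> p = q.
Proof.
move=> /precedes_ext E; apply: val_inj => /=; apply: invg_inj; apply/permP => x.
apply: card_ival_lt_inj => /=.
have H (r : sperm n) : #|[set y : sgn n | ival y < ival ((sperm_val r)^-1%g x)]| =
                       #|[set y | precedes r y x]|.
  rewrite -(card_preimset _ (@perm_inj _ (sperm_val r)^-1%g)).
  by apply: eq_card => y; rewrite !inE.
by rewrite !H; apply: eq_card => y; rewrite !inE E.
Qed.

Lemma weak_le_refl (n : nat) : reflexive (@weak_le n).
Proof. by move=> p; apply/weak_leP. Qed.

Lemma weak_le_anti (n : nat) : antisymmetric (@weak_le n).
Proof.
move=> p q /andP[/weak_leP pq /weak_leP qp]; apply: inversions_inj => r.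
by apply/idP/idP => [/pq|/qp].
Qed.

Lemma weak_le_trans (n : nat) : transitive (@weak_le n).
Proof. by move=> q p r /weak_leP pq /weak_leP qr; apply/weak_leP => v /pq /qr. Qed.

Fact weak_display : Order.disp_t. Proof. exact: Order.Disp tt tt. Qed.

HB.instance Definition _ (n : nat) :=
  Order.Le_isPOrder.Build weak_display (sperm n)
    (@weak_le_refl n) (@weak_le_anti n) (@weak_le_trans n).

(* The edge i : 'I_n.-1 joins s_i and s_(i + 1); G i = true means              *)
(* s_i -> s_(i + 1) and G i = false means s_i <- s_(i + 1).                    *)
Definition orientation (n : nat) := 'I_n.-1 -> bool.

(* Edge i puts the integers i + 1 and -(i + 1) in D and U; the integers n and  *)
(* -n belong to neither set.                                                   *)
Definition setD_of (n : nat) (G : orientation n) : {set sgn n} :=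
  [set x | [exists i : 'I_n.-1,
     ival x == if G i then (i.+1)%:Z else - (i.+1)%:Z]].

Definition setU_of (n : nat) (G : orientation n) : {set sgn n} :=
  [set x | [exists i : 'I_n.-1,
     ival x == if G i then - (i.+1)%:Z else (i.+1)%:Z]].

Definition contains_bar231 (n : nat) (G : orientation n) (p : sperm n) : bool :=
  [exists a, exists b, exists c,
    [&& ival a < ival b, ival b < ival c,
        ival (p c) < ival (p a), ival (p a) < ival (p b)
      & p a \in setU_of G]].

Definition contains_31bar2 (n : nat) (G : orientation n) (p : sperm n) : bool :=
  [exists a, exists b, exists c,
    [&& ival a < ival b, ival b < ival c,
        ival (p b) < ival (p c), ival (p c) < ival (p a)
      & p c \in setD_of G]].

Definition avoiders (n : nat) (G : orientation n) : {set sperm n} :=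
  [set p | ~~ contains_bar231 G p & ~~ contains_31bar2 G p].

Local Open Scope order_scope.

Definition left_modular (d : Order.disp_t) (L : finTBLatticeType d) (x : L) : Prop :=
  forall y z : L, y < z -> (y `|` x) `&` z = y `|` (x `&` z).

Definition chain (d : Order.disp_t) (L : finTBLatticeType d) (C : {set L}) : bool :=
  [forall x in C, forall y in C, x >=< y].

Definition join_irreducible (d : Order.disp_t) (L : finTBLatticeType d) (x : L) : bool :=
  (x != \bot) && [forall y, forall z, (x == y `|` z) ==> (x == y) || (x == z)].

Definition meet_irreducible (d : Order.disp_t) (L : finTBLatticeType d) (x : L) : bool :=
  (x != \top) && [forall y, forall z, (x == y `&` z) ==> (x == y) || (x == z)].

Definition trim (d : Order.disp_t) (L : finTBLatticeType d) : Prop :=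
  exists m : nat,
    [/\ exists C : {set L},
          [/\ maxset (@chain d L) C, #|C| = m.+1
            & forall x, x \in C -> left_modular x],
        #|[set x : L | join_irreducible x]| = m
      & #|[set x : L | meet_irreducible x]| = m].

(* A, with the order induced from P, is a (nonempty) lattice, and it is trim.  *)
Definition is_trim_lattice (d : Order.disp_t) (P : finPOrderType d)
    (A : {set P}) : Prop :=
  exists (d' : Order.disp_t) (L : finTBLatticeType d') (f : L -> P),
    [/\ {mono f : x y / x <= y}, forall a, a \in A <-> exists x, f x = a
      & trim L].

Definition is_join (d : Order.disp_t) (P : porderType d) (x y z : P) : Prop :=
  forall u : P, z <= u <-> x <= u /\ y <= u.

Definition is_meet (d : Order.disp_t) (P : porderType d) (x y z : P) : Prop :=
  forall u : P, u <= z <-> u <= x /\ u <= y.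

(* f exhibits L as the Cambrian lattice of G: it is a quotient map of lattices *)
(* from the weak order onto L, and the minimal elements of its fibres are      *)
(* exactly the avoiders.                                                       *)
Definition cambrian_quotient (n : nat) (G : orientation n)
    (d : Order.disp_t) (L : finTBLatticeType d) (f : sperm n -> L) : Prop :=
  [/\ forall x : L, exists p, f p = x,
      forall p q r, is_join p q r -> f r = f p `|` f q,
      forall p q r, is_meet p q r -> f r = f p `&` f q
    & forall p, p \in avoiders G <-> (forall q, f q = f p -> q <= p -> q = p)].

(* Main.v *)
(* Record a signed permutation by its inversion relation: a < b and b precedes a.  The avoiders
   correspond to the "aligned" relations I: symmetric under (a, b) -> (-b, -a), transitive, and
   such that I a c and a < b < c imply I a b if b is in D, hence by symmetry I b c if b is in U.
   Aligned relations are closed under intersection and the transitive closure of a union of two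
   is aligned, so meets are intersections and joins are transitive closures of unions.

   Order the roots (orbits of pairs (a, b), a < b) linearly so that ab < ac < bc if b is in D and
   bc < ac < ab if b is in U, whenever a < b < c.  Every initial segment is aligned, which gives a
   maximal chain whose length is the number m of roots.  In a chain of inversions from a to c
   some step b -> b' starts at a or in D and ends at c or in U; this yields that the initial
   segments are left modular.  The join-irreducibles are the relations generated by a single
   root r, because r is the last root of the relation it generates.  A meet-irreducible is
   determined by the first root that its upper cover contains and it does not. *)

Require Import Defs.
From HB Require Import structures.
From mathcomp Require Import all_boot all_order all_algebra all_fingroup.
From mathcomp Require Import zify.

Set Implicit Arguments.
Unset Strict Implicit.
Unset Printing Implicit Defensive.

Import Order.TTheory GRing.Theory Num.Theory.
Local Open Scope ring_scope.

(** * Inversion relations *)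

Section InversionRelation.
Variable n : nat.
Implicit Types (p q : sperm n) (a b c : sgn n) (I J : rel (sgn n)).

Lemma soppK : involutive (@sopp n).
Proof. by move=> [s k]; rewrite /sopp /= negbK. Qed.

Lemma ival_bound a : (- n%:Z <= ival a <= n%:Z) && (ival a != 0).
Proof. by case: a => [[] k]; rewrite /ival /=; have := ltn_ord k; lia. Qed.

Definition inv_rel p : rel (sgn n) := [rel a b | (ival a < ival b) && precedes p b a].

Lemma inv_opp p a b : inv_rel p (sopp b) (sopp a) = inv_rel p a b.
Proof. by rewrite /inv_rel /= precedesN !ivalN ltrN2. Qed.

Lemma precedes_irr p a : precedes p a a = false.
Proof. by rewrite /precedes ltxx. Qed.

Lemma precedes_trans p : transitive (precedes p).
Proof. by move=> b a c; rewrite /precedes; apply: lt_trans. Qed.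

Lemma precedes_inv p a b : ival a < ival b -> precedes p b a = inv_rel p a b.
Proof. by move=> ab; rewrite /inv_rel /= ab. Qed.

Lemma precedes_ninv p a b : ival a < ival b -> precedes p a b = ~~ inv_rel p a b.
Proof.
rewrite /inv_rel /= => ab; rewrite ab /= [in RHS]precedesC ?negbK //.
by apply: contraTneq ab => ->; rewrite ltxx.
Qed.

(** Up to [(a, b) -> (-b, -a)], the pairs [a < b] are [(i, j)], [(-i, i)] and [(-j, i)] with [i],
    [j] positive, one for each of the three kinds of positive roots. *)
Lemma weak_le_inv p q : reflect (subrel (inv_rel p) (inv_rel q)) (weak_le p q).
Proof.
apply: (iffP (weak_leP p q)) => [le_pq a b /= /andP[ab H] | sub v].
  rewrite /inv_rel /= ab /=.
  have pos (i j : 'I_n) : precedes p (spos i) (sneg j) ->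
      precedes q (spos i) (sneg j).
    case: (eqVneq i j) => [->|ij]; first by rewrite -!mem_inversions1; apply: le_pq.
    by rewrite -!mem_inversionsD //; apply: le_pq.
  have dif (i j : 'I_n) : (i < j)%N -> precedes p (spos j) (spos i) ->
      precedes q (spos j) (spos i).
    by move=> ij; rewrite -!mem_inversionsB //; apply: le_pq.
  case: a b ab H => [[] i] [[] j] ab H; rewrite /ival /= in ab.
  - rewrite -[precedes q _ _](precedesN q (sneg i) (sneg j)).
    rewrite -[precedes p _ _](precedesN p (sneg i) (sneg j)) in H.
    by apply: dif H; rewrite /=; lia.
  - exact: pos.
  - by lia.
  - by apply: dif H; lia.
rewrite !mem_cat; case/or3P=> /imageP[].
- move=> [i j]; rewrite inE /= => /andP[ij H] ->; apply/or3P/Or31/imageP; exists (i, j) => //.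
  rewrite inE /= ij /=.
  have/(sub (spos i)) : inv_rel p (spos i) (spos j) .
    by rewrite /inv_rel /= H ?andbT /ival /=; lia.
  by case/andP.
- move=> i H ->; apply/or3P/Or32/imageP; exists i => //.
  have/(sub (sneg i)) : inv_rel p (sneg i) (spos i).
    by move: H; rewrite inE /inv_rel /= => ->; rewrite ?andbT /ival /=; lia.
  by case/andP.
- move=> [i j]; rewrite inE /= => /andP[ij H] ->; apply/or3P/Or33/imageP; exists (i, j) => //.
  rewrite inE /= ij /=.
  have/(sub (sneg j)) : inv_rel p (sneg j) (spos i).
    by rewrite /inv_rel /= H ?andbT /ival /=; lia.
  by case/andP.
Qed.

(** Transitivity and its dual make the precedence encoded by [I] a strict total order. Matching its
    ranks with those of the integer order gives the positions, and the symmetry of [I] makes them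
    odd. *)
Lemma inv_realize I :
    (forall a b, I a b -> ival a < ival b) ->
    (forall a b, I a b -> I (sopp b) (sopp a)) ->
    transitive I ->
    (forall a b c, ival a < ival b -> ival b < ival c -> I a c -> I a b || I b c) ->
  exists p, inv_rel p =2 I.
Proof.
move=> lt_I opp_I tr_I cotr_I.
have opp_IE a b : I (sopp b) (sopp a) = I a b.
  by apply/idP/idP => /opp_I; rewrite ?soppK.
(* [a] is to precede [b] when the pair is inverted and [b < a], or not inverted and [a < b]. *)
pose prec a b := if ival b < ival a then I b a else (ival a < ival b) && ~~ I a b.
have prec_irr a : prec a a = false by rewrite /prec ltxx.
have prec_tot a b : a != b -> prec a b || prec b a.
  move=> nab; rewrite /prec; case: (ltgtP (ival a) (ival b)) => [ab|ba|/ival_inj E].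
  - by case: (I a b).
  - by case: (I b a).
  - by rewrite E eqxx in nab.
have prec_tr : transitive prec.
  move=> b a c; rewrite /prec.
  case: (ltgtP (ival a) (ival b)) => [ab|ba|/ival_inj ->] //;
    case: (ltgtP (ival b) (ival c)) => [bc|cb|/ival_inj E] //=; rewrite -?E //.
  - rewrite ltNge (ltW (lt_trans ab bc)) (lt_trans ab bc) /= => nab nbc.
    by apply/negP => /(cotr_I _ _ _ ab bc); rewrite (negPf nab) (negPf nbc).
  - move=> nab cb'; case: (ltgtP (ival a) (ival c)) => [ac|ca|/ival_inj ac] /=.
    + by apply: contra nab => /tr_I; apply.
    + by move: (cotr_I _ _ _ ca ab cb'); rewrite (negPf nab) orbF.
    + by rewrite ac cb' in nab.
  - move=> ba' nbc; case: (ltgtP (ival a) (ival c)) => [ac|ca|/ival_inj ac] /=.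
    + by apply: contra nbc; apply: tr_I.
    + by move: (cotr_I _ _ _ bc ca ba'); rewrite (negPf nbc).
    + by rewrite -ac ba' in nbc.
  - move=> ba' cb'; rewrite (lt_trans cb ba); exact: tr_I ba'.
have prec_opp a b : prec (sopp a) (sopp b) = prec b a.
  by rewrite /prec !ivalN !ltrN2 !opp_IE.
have prec_asym a b : prec a b -> prec b a = false.
  by move=> ab; apply/negP => /(prec_tr _ _ _ ab); rewrite prec_irr.
pose rk (r : rel (sgn n)) a := #|[set b | r b a]|.
have rk_lt r a b : irreflexive r -> transitive r -> r a b -> (rk r a < rk r b)%N.
  move=> irr tr ab; apply: proper_card; apply/properP; split.
    by apply/subsetP => c; rewrite !inE => ca; apply: tr ab.
  by exists a; rewrite !inE ?irr.
have rk_bound r a : irreflexive r -> (rk r a < #|{: sgn n}|)%N.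
  move=> irr; rewrite -cardsT; apply: proper_card; rewrite properE subsetT /=.
  by apply/subsetPn; exists a; rewrite !inE ?irr.
pose ltv a b := ival a < ival b.
have ltv_irr : irreflexive ltv by move=> a; rewrite /ltv ltxx.
have ltv_tr : transitive ltv by move=> b a c; apply: lt_trans.
pose rv a := Ordinal (rk_bound ltv a ltv_irr).
pose rp a := Ordinal (rk_bound prec a prec_irr).
have inj_rv : injective rv.
  move=> a b [E]; apply: ival_inj; apply/eqP; case: ltgtP => // ab;
  by have := rk_lt ltv _ _ ltv_irr ltv_tr ab; rewrite E ltnn.
have inj_rp : injective rp.
  move=> a b [E]; apply/eqP; case: eqP => // /eqP /prec_tot /orP[] ab;
  by have := rk_lt prec _ _ prec_irr prec_tr ab; rewrite E ltnn.
have [rvi rvK rviK] : bijective rv by apply: inj_card_bij; rewrite ?card_ord.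
(* In a total order reversed by [sopp], the elements before [-a] correspond to those after [a]. *)
have rk_opp r a : irreflexive r -> (forall a b, r (sopp a) (sopp b) = r b a) ->
    (forall a b, a != b -> r a b || r b a) -> transitive r ->
    (rk r (sopp a) + rk r a).+1 = #|{: sgn n}|.
  move=> irr opp tot tr.
  have -> : rk r (sopp a) = #|[set b | r a b]|.
    rewrite /rk -(card_imset _ (inv_inj soppK)); apply: eq_card => b.
    rewrite !inE; apply/imsetP/idP => [[c]|ab].
      by rewrite inE => ca ->; rewrite -opp soppK.
    by exists (sopp b); rewrite ?inE ?opp ?soppK.
  rewrite -[RHS]cardsT [RHS](cardsD1 a) in_setT add1n; congr _.+1.
  rewrite /rk -cardsUI [X in (_ + X)%N]eq_card0 ?addn0.
    apply: eq_card => b; rewrite !inE andbT.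
    case: (eqVneq b a) => [->|/tot]; first by rewrite irr.
    by case: (r b a); case: (r a b).
  by move=> b; rewrite !inE; apply/negP => /andP[ab /(tr _ _ _ ab)]; rewrite irr.
pose pos a := rvi (rp a).
have inj_pos : injective pos by move=> a b /(can_inj rviK) /inj_rp.
have pos_opp a : pos (sopp a) = sopp (pos a).
  apply: inj_rv; rewrite /pos rviK; apply: val_inj; rewrite /=.
  have ltv_opp b c : ltv (sopp b) (sopp c) = ltv c b by rewrite /ltv !ivalN ltrN2.
  have ltv_tot b c : b != c -> ltv b c || ltv c b.
    by move=> nbc; rewrite /ltv -neq_lt; apply: contra_neq nbc; apply: ival_inj.
  have := rk_opp ltv (rvi (rp a)) ltv_irr ltv_opp ltv_tot ltv_tr.
  have := rk_opp prec a prec_irr prec_opp prec_tot prec_tr.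
  have : rk ltv (rvi (rp a)) = rk prec a by have := congr1 val (rviK (rp a)).
  by lia.
have pos_prec a b : (ival (pos a) < ival (pos b)) = prec a b.
  have rv_pos c : rk ltv (pos c) = rk prec c by have := congr1 val (rviK (rp c)).
  apply/idP/idP => [lt_ab|ab].
    case: (eqVneq a b) => [E|/prec_tot /orP[] // ba]; first by rewrite E ltxx in lt_ab.
    have := rk_lt _ _ _ prec_irr prec_tr ba; rewrite -!rv_pos.
    by have := rk_lt _ _ _ ltv_irr ltv_tr lt_ab; lia.
  rewrite ltNge le_eqVlt; apply/negP => /orP[/eqP/ival_inj/inj_pos E|lt_ba].
    by rewrite E prec_irr in ab.
  have := rk_lt _ _ _ prec_irr prec_tr ab; rewrite -!rv_pos.
  by have := rk_lt _ _ _ ltv_irr ltv_tr lt_ba; lia.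
(* [pos] sends a value to its position, so it is the inverse of the permutation sought. *)
pose s := (perm inj_pos)^-1%g.
have signed_s : is_signed s.
  apply/forallP => a; apply/eqP; apply: (@perm_inj _ (perm inj_pos)).
  by rewrite permKV permE pos_opp -[in RHS](permE inj_pos) permKV.
exists (SPerm signed_s) => a b; rewrite /inv_rel /= /precedes /= invgK !permE pos_prec /prec.
by case: ifP => //= /negbT nab; apply/esym/negP => /lt_I; rewrite (negPf nab).
Qed.

End InversionRelation.

(** * Aligned relations *)

Section Aligned.
Variables (n : nat) (D : pred (sgn n)).
(** The neighbours [a] and [c] exclude [b = n] and [b = -n], which lie in neither [D] nor [U]. *)
Hypothesis D_opp : forall a b c : sgn n,
  ival a < ival b -> ival b < ival c -> D (sopp b) = ~~ D b.
Implicit Types (a b c : sgn n) (I J X Y Z : rel (sgn n)).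

Definition aligned I :=
  [/\ forall a b, I a b -> ival a < ival b,
      forall a b, I a b -> I (sopp b) (sopp a),
      transitive I
    & forall a b c, ival a < ival b -> ival b < ival c -> D b -> I a c -> I a b].

(** For [b] in [D] the roots are ordered [ab < ac < bc]. Alignment gives the descent from [ac] to
    [ab]; this is the descent from [bc] to [ac]. *)
Definition initial I :=
  forall a b c, ival a < ival b -> ival b < ival c -> D b -> I b c -> I a c.

(** The mirror image of the last clause of [aligned], since [D_opp] exchanges [D] and its
    complement. *)
Lemma aligned_up I a b c : aligned I ->
  ival a < ival b -> ival b < ival c -> ~~ D b -> I a c -> I b c.
Proof.
move=> [_ opp_I _ al_I] ab bc nDb /opp_I ac.
rewrite -(soppK b) -(soppK c); apply/opp_I.
by apply: al_I ac; rewrite ?ivalN ?ltrN2 // (D_opp ab bc).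
Qed.

Lemma initial_up I a b c : aligned I -> initial I ->
  ival a < ival b -> ival b < ival c -> ~~ D b -> I a b -> I a c.
Proof.
move=> [_ opp_I _ _] in_I ab bc nDb /opp_I ba.
rewrite -(soppK a) -(soppK c); apply/opp_I.
by apply: in_I ba; rewrite ?ivalN ?ltrN2 // (D_opp ab bc).
Qed.

(** Alignment refines the dual of transitivity: [D] decides which of [I a b] and [I b c] follows
    from [I a c]. *)
Lemma aligned_realize I : aligned I -> exists p : sperm n, inv_rel p =2 I.
Proof.
move=> al_I; have [lt_I opp_I tr_I dn_I] := al_I.
apply: inv_realize => // a b c ab bc ac.
case: (boolP (D b)) => Db; first by rewrite (dn_I _ _ _ ab bc Db ac).
by rewrite (aligned_up al_I ab bc Db ac) orbT.
Qed.

Lemma aligned_eq I J : I =2 J -> aligned I -> aligned J.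
Proof.
move=> E [lt_I opp_I tr_I dn_I]; split=> [a b|a b|b a c|a b c].
- by rewrite -E; apply: lt_I.
- by rewrite -!E; apply: opp_I.
- by rewrite -!E; apply: tr_I.
- by rewrite -!E; apply: dn_I.
Qed.

Lemma aligned_bigcap (T : finType) (P : pred T) (F : T -> rel (sgn n)) t0 :
    P t0 -> (forall t, P t -> aligned (F t)) ->
  aligned (fun a b => [forall (t | P t), F t a b]).
Proof.
move=> Pt0 al; split=> [a b|a b|b a c|a b c].
- by move=> /forall_inP/(_ _ Pt0); case: (al _ Pt0) => lt_F _ _ _ /lt_F.
- by move=> /forall_inP H; apply/forall_inP => t Pt; have [_ opp _ _] := al _ Pt; apply/opp/H.
- move=> /forall_inP H /forall_inP H'; apply/forall_inP => t Pt.
  by have [_ _ tr _] := al _ Pt; apply: tr (H _ Pt) (H' _ Pt).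
- move=> ab bc Db /forall_inP H; apply/forall_inP => t Pt.
  by have [_ _ _ dn] := al _ Pt; apply: dn (H _ Pt).
Qed.

Lemma aligned_cap I J : aligned I -> aligned J -> aligned (fun a b => I a b && J a b).
Proof.
move=> [lt_I opp_I tr_I dn_I] [_ opp_J tr_J dn_J]; split=> [a b|a b|b a c|a b c].
- by case/andP => /lt_I.
- by case/andP=> /opp_I-> /opp_J.
- by case/andP=> ab ab' /andP[bc bc']; rewrite (tr_I _ _ _ ab bc) (tr_J _ _ _ ab' bc').
- by move=> ab bc Db /andP[/(dn_I _ _ _ ab bc Db)-> /(dn_J _ _ _ ab bc Db)].
Qed.

(** * Transitive closure of the union of two aligned relations *)

Definition cup I J : rel (sgn n) := [rel a b | I a b || J a b].
(** [connect] is the reflexive transitive closure; steps of aligned relations strictly increase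
    values, so removing the diagonal leaves the transitive closure. *)
Definition hull I J : rel (sgn n) := [rel a b | (a != b) && connect (cup I J) a b].

Section Hull.
Variables I J : rel (sgn n).
Hypotheses (al_I : aligned I) (al_J : aligned J).

Lemma cup_lt a b : cup I J a b -> ival a < ival b.
Proof. by case: al_I al_J => [lt_I _ _ _] [lt_J _ _ _] /orP[/lt_I|/lt_J]. Qed.

Lemma connect_cup_le a b : connect (cup I J) a b -> ival a <= ival b.
Proof.
case/connectP => s; elim: s a => [a _ -> //|d s IHs a /= /andP[/cup_lt ad p E]].
exact: le_trans (ltW ad) (IHs _ p E).
Qed.

Lemma hull_lt a b : hull I J a b -> ival a < ival b.
Proof.
case/andP => nab /connect_cup_le; rewrite le_eqVlt => /orP[/eqP/ival_inj E|//].
by rewrite E eqxx in nab.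
Qed.

Lemma cup_hull a b : cup I J a b -> hull I J a b.
Proof.
move=> ab; rewrite /hull /= connect1 // andbT.
by apply: contraTneq (cup_lt ab) => ->; rewrite ltxx.
Qed.

(** For the last clause, some step of a chain from [a] to [c] ends at [b] or jumps over it; in the
    second case alignment of the relation containing that step cuts it at [b]. *)
Lemma aligned_hull : aligned (hull I J).
Proof.
have lt_neq a b : ival a < ival b -> a != b.
  by move=> ab; apply: contraTneq ab => ->; rewrite ltxx.
split=> [a b|a b|b a c ab bc|a b c ab bc Db].
- exact: hull_lt.
- case/andP => nab /connectP[s]; rewrite /hull /= => p E.
  rewrite (inj_eq (inv_inj (@soppK n))) eq_sym nab /= {nab}.
  elim: s a p E => [a _ -> //|d s IHs a /= /andP[ad p] E].
  apply: connect_trans (IHs _ p E) (connect1 _).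
  case: al_I al_J ad => [_ opp_I _ _] [_ opp_J _ _].
  by case/orP => [/opp_I|/opp_J]; rewrite /cup /= => ->; rewrite ?orbT.
- rewrite /hull /= lt_neq ?(lt_trans (hull_lt ab) (hull_lt bc)) //=.
  by case/andP: ab bc => _ ab /andP[_]; apply: connect_trans.
- case/andP => _ /connectP[s]; rewrite /hull /= (lt_neq _ _ ab) /=.
  elim: s a ab => [a ab _ E|d s IHs a ab /= /andP[ad p] E].
    by rewrite E in bc; have := lt_trans ab bc; rewrite ltxx.
  case: (ltgtP (ival b) (ival d)) => [bd|db|/ival_inj ->]; last exact: connect1.
    apply: connect1; case: al_I al_J ad => [_ _ _ dn_I] [_ _ _ dn_J].
    by case/orP => [/(dn_I _ _ _ ab bd Db)|/(dn_J _ _ _ ab bd Db)];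
      rewrite /cup /= => ->; rewrite ?orbT.
  exact: connect_trans (connect1 ad) (IHs d db p E).
Qed.

(* Along a chain from [a] to [c] there is a last step leaving [a] or a vertex in [D]; it
   enters [c] or a vertex outside [D]. *)
Lemma hull_step a c : hull I J a c -> exists b b',
  [/\ cup I J b b', b = a \/ hull I J a b /\ D b
    & b' = c \/ hull I J b' c /\ ~~ D b'].
Proof.
have [_ _ tr_H _] := aligned_hull.
case/andP=> nac /connectP[s]; elim: s a nac => [a nac _ E|d s IHs a nac /= /andP[ad p] E].
  by rewrite E eqxx in nac.
have had := cup_hull ad.
case: (eqVneq d c) => [dc|ndc]; first by exists a, d; split; [| left | left].
have hdc : hull I J d c by rewrite /hull /= ndc; apply/connectP; exists s.
case: (boolP (D d)) => Dd; last by exists a, d; split; [| left | right].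
have [b [b' [bb' bd b'c]]] := IHs d ndc p E.
exists b, b'; split=> //; right; case: bd => [->|[db Db]]; first by [].
by split=> //; apply: tr_H had db.
Qed.

End Hull.

(** The core of left modularity, with [V] in the role of the join of [Y] with the meet of [X] and
    [Z]. Alignment of [Z] puts [ab] and [b'c] in [Z] for the step [bb'] of [hull_step], so induction
    on the distance from [a] to [c] puts them in [V]. *)
Lemma hull_modular X Y Z V a c : aligned X -> aligned Y -> aligned Z -> initial X ->
    transitive V -> subrel Y V -> (forall a b, X a b -> Z a b -> V a b) ->
  hull X Y a c -> Z a c -> V a c.
Proof.
move=> al_X al_Y al_Z in_X tr_V sub_YV sub_XZV.
have [k] := ubnP `|ival c - ival a|%N; elim: k a c => // k IHk a c lt_k ac Zac.
have lt_H := hull_lt al_X al_Y.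
have lt_ac := lt_H _ _ ac.
have [b [b' [bb' ab b'c]]] := hull_step al_X al_Y ac.
have lt_bb' := cup_lt al_X al_Y bb'.
have {}ab : b = a \/ [/\ ival a < ival b, V a b & D b].
  case: ab => [->|[ab Db]]; [by left | right].
  have lt_ab := lt_H _ _ ab; have lt_bc : ival b < ival c.
    by case: b'c => [<- //|[/lt_H lt_b'c _]]; apply: lt_trans lt_bb' lt_b'c.
  have [_ _ _ dn_Z] := al_Z.
  by split=> //; apply: IHk => //; [lia | apply: dn_Z Zac].
have {}b'c : b' = c \/ [/\ ival b' < ival c, V b' c & ~~ D b'].
  case: b'c => [->|[b'c Db']]; [by left | right].
  have lt_b'c := lt_H _ _ b'c; have lt_ab' : ival a < ival b'.
    by case: ab => [<- //|[lt_ab _ _]]; apply: lt_trans lt_ab lt_bb'.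
  by split=> //; apply: IHk => //; [lia | apply: aligned_up Zac].
(* A step in [X] stretches to [ac] because [X] is initial, and [ac] is in [Z] too. A step in [Y] is
   composed with [ab] and [b'c] inside [V]. *)
case/orP: bb' => [Xbb'|/sub_YV Vbb'].
  have {}Xab' : X a b'.
    by case: ab => [<- //|[lt_ab _ Db]]; apply: in_X Xbb'.
  apply: sub_XZV => //; case: b'c => [<- //|[lt_b'c _ Db']].
  apply: initial_up Xab' => //; case: ab => [<- //|[lt_ab _ _]].
  exact: lt_trans lt_ab lt_bb'.
have Vab' : V a b' by case: ab => [<- //|[_ Vab _]]; apply: tr_V Vab Vbb'.
by case: b'c => [<- //|[_ Vb'c _]]; apply: tr_V Vab' Vb'c.
Qed.

(** In [hull_step] the parts [ab] and [b'c] lie in both relations, so whichever relation contains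
    the step [bb'] contains [ac]. *)
Lemma hull_semidistributive I J a c : aligned I -> aligned J ->
    (forall b, ival a < ival b -> ival b < ival c -> D b -> I a b && J a b) ->
    (forall b, ival a < ival b -> ival b < ival c -> ~~ D b -> I b c && J b c) ->
  hull I J a c -> I a c || J a c.
Proof.
move=> al_I al_J dn up ac.
have lt_H := hull_lt al_I al_J; have lt_ac := lt_H _ _ ac.
have [b [b' [bb' ab b'c]]] := hull_step al_I al_J ac.
have lt_bb' := cup_lt al_I al_J bb'.
have {}ab : b = a \/ I a b && J a b.
  case: ab => [->|[/lt_H lt_ab Db]]; [by left | right; apply: dn => //].
  by case: b'c => [<- //|[/lt_H lt_b'c _]]; apply: lt_trans lt_bb' lt_b'c.
have le_ab : ival a <= ival b.
  case: ab => [-> //|/andP[Iab _]]; have [lt_I _ _ _] := al_I; exact/ltW/lt_I.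
have {}b'c : b' = c \/ I b' c && J b' c.
  case: b'c => [->|[/lt_H lt_b'c Db']]; [by left | right; apply: up => //].
  exact: le_lt_trans le_ab lt_bb'.
have [[_ _ tr_I _] [_ _ tr_J _]] := (al_I, al_J).
have go (K : rel (sgn n)) : transitive K -> (b = a \/ K a b) -> (b' = c \/ K b' c) ->
    K b b' -> K a c.
  move=> tr_K ab_ b'c_ Kbb'; have Kab' : K a b'.
    by case: ab_ => [<- //|Kab]; apply: tr_K Kab Kbb'.
  by case: b'c_ => [<- //|Kb'c]; apply: tr_K Kab' Kb'c.
case/orP: bb' => [/(go I tr_I)|/(go J tr_J)] ->; rewrite ?orbT //.
- by case: ab => [|/andP[]]; [left | right].
- by case: b'c => [|/andP[]]; [left | right].
- by case: ab => [|/andP[]]; [left | right].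
- by case: b'c => [|/andP[]]; [left | right].
Qed.

(** * A linear order on the roots *)

(* Ranks the right endpoints: those in [D] in increasing order, then [n], then the others in
   decreasing order. *)
Definition endpoint_rank b : int := if D b then ival b - n%:Z else n%:Z - ival b.
(** The orbit of [(a, b)] has right endpoints [b] and [-a]; summing their ranks gives a function of
    the orbit. *)
Definition height (r : sgn n * sgn n) : int :=
  endpoint_rank r.2 + endpoint_rank (sopp r.1).

Lemma height_opp a b : height (sopp b, sopp a) = height (a, b).
Proof. by rewrite /height /= soppK addrC. Qed.

(** An element [b] of [D] ranks below every larger [c], while [-b], outside [D], ranks above every
    larger [-a]. *)
Lemma height_lt a b c : ival a < ival b -> ival b < ival c -> D b ->
  height (a, b) < height (a, c) /\ height (a, c) < height (b, c).
Proof.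
move=> ab bc Db; rewrite /height /= ltrD2r ltrD2l /endpoint_rank Db (D_opp ab bc) Db /=.
rewrite !ivalN; have := ival_bound a; have := ival_bound c.
by split; case: ifP => _; lia.
Qed.

Lemma height_up a b c : ival a < ival b -> ival b < ival c -> ~~ D b ->
  height (b, c) < height (a, c) /\ height (a, c) < height (a, b).
Proof.
move=> ab bc nDb; rewrite -![height (_, c)]height_opp -[height (a, b)]height_opp.
by apply: height_lt; rewrite ?ivalN ?ltrN2 // (D_opp ab bc).
Qed.

(** The two pairs of an orbit have opposite sums, and they coincide when the sum is zero. *)
Definition root_rep (r : sgn n * sgn n) : sgn n * sgn n :=
  if 0 <= ival r.1 + ival r.2 then r else (sopp r.2, sopp r.1).

(** Ties in height are broken arbitrarily: the comparisons required of [ab], [ac] and [bc] are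
    strict in height. *)
Definition root_seq : seq (sgn n * sgn n) :=
  sort (fun r r' => height r <= height r')
    [seq r <- enum {: sgn n * sgn n} | (ival r.1 < ival r.2) && (0 <= ival r.1 + ival r.2)].

Definition root_index a b : nat := index (root_rep (a, b)) root_seq.

Lemma root_seq_uniq : uniq root_seq.
Proof. by rewrite sort_uniq filter_uniq // enum_uniq. Qed.

Lemma mem_root_seq r :
  (r \in root_seq) = (ival r.1 < ival r.2) && (0 <= ival r.1 + ival r.2).
Proof. by rewrite mem_sort mem_filter mem_enum andbT. Qed.

Lemma mem_root_rep a b : ival a < ival b -> root_rep (a, b) \in root_seq.
Proof. by move=> ab; rewrite mem_root_seq /root_rep; case: ifP => /=; rewrite ?ivalN; lia. Qed.

Lemma root_index_lt_size a b : ival a < ival b -> (root_index a b < size root_seq)%N.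
Proof. by move=> ab; rewrite index_mem mem_root_rep. Qed.

Lemma root_index_opp a b : root_index (sopp b) (sopp a) = root_index a b.
Proof.
rewrite /root_index /root_rep /= !ivalN !soppK.
case: ifP => H1; case: ifP => H2 //; last by lia.
have -> : a = sopp b by apply: ival_inj; rewrite ivalN; lia.
by rewrite soppK.
Qed.

Lemma root_index_nth i r0 : (i < size root_seq)%N ->
  let r := nth r0 root_seq i in ival r.1 < ival r.2 /\ root_index r.1 r.2 = i.
Proof.
move=> lt_i r; have : r \in root_seq by apply: mem_nth.
rewrite mem_root_seq => /andP[lt_r pos_r]; split=> //.
by rewrite /root_index /root_rep /= pos_r -surjective_pairing index_uniq // root_seq_uniq.
Qed.

Lemma root_index_inj a b c d : ival a < ival b -> root_index a b = root_index c d ->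
  (a, b) = (c, d) \/ (a, b) = (sopp d, sopp c).
Proof.
move=> ab E; have : root_rep (a, b) = root_rep (c, d).
  rewrite -(nth_index (a, b) (mem_root_rep ab)) -/(root_index a b) E.
  by rewrite nth_index // -index_mem -/(root_index c d) -E root_index_lt_size.
rewrite /root_rep; case: ifP => _; case: ifP => _ /= Er;
  move: (congr1 fst Er) (congr1 snd Er) => /= E1 E2.
- by left; rewrite E1 E2.
- by right; rewrite E1 E2.
- by right; rewrite -E1 -E2 !soppK.
- by left; rewrite -(soppK a) -(soppK b) E1 E2 !soppK.
Qed.

Lemma root_index_lt a b c d : ival a < ival b -> ival c < ival d ->
  height (a, b) < height (c, d) -> (root_index a b < root_index c d)%N.
Proof.
have rep x y : height (root_rep (x, y)) = height (x, y).
  by rewrite /root_rep; case: ifP; rewrite ?height_opp.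
move=> ab cd; rewrite -rep -[ltRHS]rep ltNge ltnNge; apply: contra => le_i.
set lr := fun r r' => height r <= height r'.
have tr : transitive lr by move=> ? ? ?; apply: le_trans.
have srt : sorted lr root_seq by apply: sort_sorted => ? ?; apply: le_total.
rewrite -(nth_index (a, b) (mem_root_rep ab)) -(nth_index (a, b) (mem_root_rep cd)).
apply: (sorted_leq_nth tr _ _ srt) => //; first by move=> ?; apply: lexx.
- by rewrite inE index_mem mem_root_rep.
- by rewrite inE index_mem mem_root_rep.
Qed.

Lemma root_index_dn a b c : ival a < ival b -> ival b < ival c -> D b ->
  (root_index a b < root_index a c)%N /\ (root_index a c < root_index b c)%N.
Proof.
move=> ab bc Db; have ac := lt_trans ab bc.
by have [h1 h2] := height_lt ab bc Db; split; apply: root_index_lt.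
Qed.

Lemma root_index_up a b c : ival a < ival b -> ival b < ival c -> ~~ D b ->
  (root_index b c < root_index a c)%N /\ (root_index a c < root_index a b)%N.
Proof.
move=> ab bc Db; have ac := lt_trans ab bc.
by have [h1 h2] := height_up ab bc Db; split; apply: root_index_lt.
Qed.

Definition prefix_rel i : rel (sgn n) :=
  [rel a b | (ival a < ival b) && (root_index a b < i)%N].

(** Transitivity holds because [ac] always lies between [ab] and [bc] in the root order. *)
Lemma prefix_aligned i : aligned (prefix_rel i).
Proof.
split=> [a b|a b|b a c|a b c ab bc Db].
- by case/andP.
- by rewrite /prefix_rel /= !ivalN ltrN2 root_index_opp.
- case/andP=> ab iab /andP[bc ibc]; rewrite /prefix_rel /= (lt_trans ab bc) /=.
  case: (boolP (D b)) => Db.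
    by have [_ /ltn_trans->] := root_index_dn ab bc Db.
  by have [_ /ltn_trans->] := root_index_up ab bc Db.
- case/andP => _ iac; rewrite /prefix_rel /= ab /=.
  by have [/ltn_trans->] := root_index_dn ab bc Db.
Qed.

Lemma prefix_initial i : initial (prefix_rel i).
Proof.
move=> a b c ab bc Db /andP[_ ibc]; rewrite /prefix_rel /= (lt_trans ab bc) /=.
by have [_ /ltn_trans->] := root_index_dn ab bc Db.
Qed.

End Aligned.

(** * Lattices of aligned relations *)

Local Open Scope order_scope.

Lemma join_irreducible_big (d : Order.disp_t) (L : finTBLatticeType d) (T : Type)
    (s : seq T) (P : pred T) (F : T -> L) (x : L) :
  join_irreducible x -> x = \join_(t <- s | P t) F t -> exists2 t, P t & x = F t.
Proof.
case/andP=> x_neq0 /forallP ji; elim: s => [|t s IHs].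
  by rewrite big_nil => E; rewrite E eqxx in x_neq0.
rewrite big_cons; case: ifP => // Pt E.
have /orP[/eqP xt|/eqP /IHs //] := implyP (forallP (ji _) _) (introT eqP E).
by exists t.
Qed.

Lemma meet_irreducible_big (d : Order.disp_t) (L : finTBLatticeType d) (T : Type)
    (s : seq T) (P : pred T) (F : T -> L) (x : L) :
  meet_irreducible x -> x = \meet_(t <- s | P t) F t -> exists2 t, P t & x = F t.
Proof.
case/andP=> x_neq1 /forallP mi; elim: s => [|t s IHs].
  by rewrite big_nil => E; rewrite E eqxx in x_neq1.
rewrite big_cons; case: ifP => // Pt E.
have /orP[/eqP xt|/eqP /IHs //] := implyP (forallP (mi _) _) (introT eqP E).
by exists t.
Qed.

Section AlignedLattice.
Variables (n : nat) (D : pred (sgn n)).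
Hypothesis D_opp : forall a b c : sgn n,
  (ival a < ival b)%R -> (ival b < ival c)%R -> D (sopp b) = ~~ D b.
Variables (d : Order.disp_t) (L : finTBLatticeType d) (I : L -> rel (sgn n)).
(** With the next two hypotheses, [I] identifies the order of [L] with inclusion of aligned
    relations. *)
Hypothesis I_le : forall x y, reflect (subrel (I x) (I y)) (x <= y).
Hypothesis I_aligned : forall x, aligned D (I x).
Hypothesis I_onto : forall J, aligned D J -> exists x, I x =2 J.
Implicit Types (x y z : L) (a b c : sgn n) (J : rel (sgn n)).

Lemma I_top a b : (ival a < ival b)%R -> I \top a b.
Proof.
(* The prefix of all roots is the whole relation [a < b]. *)
move=> ab; have [x Ix] := I_onto (prefix_aligned D_opp (size (root_seq D))).
by apply: (I_le x \top (lex1 x)); rewrite Ix /prefix_rel /= ab root_index_lt_size.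
Qed.

Lemma I_meet x y a b : I (x `&` y) a b = I x a b && I y a b.
Proof.
have [w Iw] := I_onto (aligned_cap (I_aligned x) (I_aligned y)).
apply/idP/andP => [xy|[xab yab]].
  by split; apply: I_le xy; rewrite ?leIl ?leIr.
have /I_le : w <= x `&` y.
  by rewrite lexI; apply/andP; split; apply/I_le => e f; rewrite Iw => /andP[].
by apply; rewrite Iw xab.
Qed.

Lemma I_join x y a b : I (x `|` y) a b -> hull (I x) (I y) a b.
Proof.
have [w Iw] := I_onto (aligned_hull (I_aligned x) (I_aligned y)).
have /I_le sub : x `|` y <= w.
  by rewrite leUx; apply/andP; split; apply/I_le => e f ef; rewrite Iw;
    apply: (cup_hull (I_aligned x) (I_aligned y)); rewrite /cup /= ef ?orbT.
by move/sub; rewrite Iw.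
Qed.

Definition gen J : L := \meet_(x | [forall a, forall b, J a b ==> I x a b]) x.

(** The intersection of all aligned relations containing [J] is aligned, hence realized in [L], so
    the meet defining [gen J] still contains [J]. *)
Lemma gen_le J x : (forall a b, J a b -> (ival a < ival b)%R) ->
  reflect (subrel J (I x)) (gen J <= x).
Proof.
move=> lt_J.
pose P : pred L := fun y => [forall a, forall b, J a b ==> I y a b].
have subP y : reflect (subrel J (I y)) (P y).
  by apply: (iffP 'forall_'forall_implyP) => sub a b; apply: sub.
have J_top : P \top.
  by apply/subP => a b /lt_J /I_top.
have sub_gen : subrel J (I (gen J)).
  have [w Iw] := I_onto (aligned_bigcap (P := P) J_top (fun y _ => I_aligned y)).
  have le_w : w <= gen J.
    by apply/meetsP => y Jy; apply/I_le => a b; rewrite Iw => /forall_inP; apply.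
  move=> a b Jab; apply: (I_le _ _ le_w); rewrite Iw.
  by apply/forall_inP => y /subP; apply.
apply: (iffP idP) => [le_x a b /sub_gen | sub_x]; first exact: I_le.
exact/meets_inf/subP.
Qed.

Lemma I_gen J : aligned D J -> I (gen J) =2 J.
Proof.
move=> al_J; have [lt_J _ _ _] := al_J; have [w Iw] := I_onto al_J.
move=> a b; apply/idP/idP => [|Jab].
  by rewrite -Iw; apply: I_le; apply/gen_le => // e f; rewrite Iw.
by move/(gen_le _ lt_J): (lexx (gen J)); apply.
Qed.

Definition pre i := gen (prefix_rel D i).

Lemma I_pre i : I (pre i) =2 prefix_rel D i.
Proof. exact/I_gen/prefix_aligned. Qed.

Lemma pre_left_modular i : left_modular (pre i).
Proof.
move=> y z lt_yz; apply: le_anti; rewrite lexI !leUx.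
rewrite leUl (ltW lt_yz) leIr (le_trans (leIl _ _) (leUr _ _)) !andbT.
(* The other inequality holds in every lattice; this one is [hull_modular]. *)
apply/I_le => a b; rewrite I_meet joinC => /andP[/I_join hab zab].
apply: (hull_modular D_opp (I_aligned (pre i)) (I_aligned y) (I_aligned z)) hab zab.
- move=> e f g ef fg Df; rewrite !I_pre; exact: (prefix_initial D_opp) ef fg Df.
- by case: (I_aligned (y `|` pre i `&` z)).
- by apply/I_le/leUl.
- move=> e f ef zef; apply: (I_le (pre i `&` z)); first exact: leUr.
  by rewrite I_meet ef.
Qed.

(** * Roots of an element and the maximal chain *)

Local Notation m := (size (root_seq D)).

Definition root_at (i : 'I_m) : sgn n * sgn n := tnth (in_tuple (root_seq D)) i.
Definition has_root x (i : 'I_m) : bool := I x (root_at i).1 (root_at i).2.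

Lemma root_lt i : (ival (root_at i).1 < ival (root_at i).2)%R.
Proof.
rewrite /root_at (tnth_nth (root_at i)).
by have [] := root_index_nth (root_at i) (ltn_ord i).
Qed.

Lemma root_indexE i : root_index D (root_at i).1 (root_at i).2 = i.
Proof.
rewrite /root_at (tnth_nth (root_at i)).
by have [] := root_index_nth (root_at i) (ltn_ord i).
Qed.

Lemma has_rootE a b : (ival a < ival b)%R ->
  exists2 i : 'I_m, root_index D a b = i & forall x, I x a b = has_root x i.
Proof.
move=> ab; exists (Ordinal (root_index_lt_size D ab)) => // x.
set i := Ordinal _; have := root_index_inj ab (esym (root_indexE i)).
have [_ opp_I _ _] := I_aligned x; rewrite /has_root.
case=> E; move: (congr1 fst E) (congr1 snd E) => /= -> ->; first by [].
by apply/idP/idP => /opp_I; rewrite ?soppK.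
Qed.

Lemma has_root_le x y : reflect (forall i, has_root x i -> has_root y i) (x <= y).
Proof.
apply: (iffP (I_le x y)) => [sub i|sub a b ab]; first exact: sub.
have [lt_I _ _ _] := I_aligned x.
by have [i _ E] := has_rootE (lt_I _ _ ab); move: ab; rewrite !E; apply: sub.
Qed.

Lemma has_root_pre k i : has_root (pre k) i = (i < k)%N.
Proof. by rewrite /has_root I_pre /prefix_rel /= root_lt root_indexE. Qed.

Lemma has_root_top i : has_root \top i.
Proof. exact/I_top/root_lt. Qed.

Lemma pre_le i k : (i <= m)%N -> (pre i <= pre k) = (i <= k)%N.
Proof.
move=> le_im; apply/has_root_le/idP => [sub|le_ik j]; last first.
  by rewrite !has_root_pre => /leq_trans->.
rewrite leqNgt; apply/negP => lt_ki; have lt_km := leq_trans lt_ki le_im.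
by have := sub (Ordinal lt_km); rewrite !has_root_pre lt_ki ltnn => /(_ isT).
Qed.

(** Along a chain the number of roots, between [0] and [m], is injective, so no chain has more than
    [m.+1] elements. *)
Lemma pre_maxchain : let C := [set pre i | i : 'I_m.+1] in
  maxset (@chain d L) C /\ #|C| = m.+1.
Proof.
move=> C; have card_C : #|C| = m.+1.
  rewrite card_imset ?card_ord // => i k E; apply/val_inj/anti_leq.
  have le_m (j : 'I_m.+1) : (j <= m)%N by rewrite -ltnS.
  by rewrite -(pre_le k (le_m i)) -(pre_le i (le_m k)) E lexx.
split=> //; apply/maxsetP; split=> [|B /forall_inP ch_B sub_CB].
  apply/forall_inP => _ /imsetP[i _ ->]; apply/forall_inP => _ /imsetP[k _ ->].
  rewrite /Order.comparable (pre_le _ (ltnSE (ltn_ord i))) (pre_le _ (ltnSE (ltn_ord k))).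
  exact: leq_total.
apply/esym/eqP; rewrite eqEcard sub_CB card_C /=.
have inj_card : {in B &, injective (fun x => inord #|has_root x| : 'I_m.+1)}.
  have anti x y : x <= y -> #|has_root x| = #|has_root y| -> x = y.
    move=> le_xy E; apply/le_anti; rewrite le_xy /=; apply/has_root_le => i.
    have sub : has_root x \subset has_root y.
      by apply/subsetP => k; apply: (has_root_le _ _ le_xy).
    by have := subset_cardP E sub i; rewrite -!topredE /= => ->.
  move=> x y Bx By /(congr1 val); rewrite /= !inordK ?ltnS;
    try by rewrite -[leqRHS](card_ord m) max_card.
  move=> E; have /orP[le_xy|le_yx] := forall_inP (ch_B _ Bx) _ By; first exact: anti.
  exact/esym/anti.
by rewrite -(card_in_imset inj_card) -[leqRHS](card_ord m.+1) max_card.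
Qed.

(** * Join-irreducibles *)

Definition gen_root i := gen [rel a b | (a, b) == root_at i].

Lemma gen_root_le i x : (gen_root i <= x) = has_root x i.
Proof.
apply/gen_le/idP => [a b /eqP E|sub|xi a b /eqP E].
- by have := root_lt i; rewrite -E.
- by apply: sub; rewrite /= -surjective_pairing.
- by move: xi; rewrite /has_root -E.
Qed.

Lemma has_root_gen i : has_root (gen_root i) i.
Proof. by rewrite -gen_root_le. Qed.

(** The first [i.+1] roots form an aligned relation containing root [i], hence everything it
    generates. *)
Lemma gen_root_index i k : has_root (gen_root i) k -> (k <= i)%N.
Proof.
have le_pre : gen_root i <= pre i.+1 by rewrite gen_root_le has_root_pre.
by move/(has_root_le _ _ le_pre); rewrite has_root_pre.
Qed.

Lemma gen_root_inj : injective gen_root.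
Proof.
move=> i k E; apply/val_inj/anti_leq; rewrite !gen_root_index //.
  by rewrite E has_root_gen.
by rewrite -E has_root_gen.
Qed.

(** Every element is the join of the [gen_root i] over its roots. Conversely, elements strictly
    below [gen_root i] miss its last root, so they lie below [pre i], and so do their joins. *)
Lemma join_irreducibleE :
  [set x : L | join_irreducible x] = [set gen_root i | i : 'I_m].
Proof.
apply/setP => x; rewrite inE; apply/idP/imsetP => [ji|[i _ ->]].
  have E : x = \join_(i | has_root x i) gen_root i.
    apply/le_anti; rewrite andbC; apply/andP; split.
      by apply/joinsP => i; rewrite gen_root_le.
    apply/has_root_le => i xi; rewrite -gen_root_le.
    exact: joins_sup.
  by have [i xi ->] := join_irreducible_big ji E; exists i.
apply/andP; split.
  apply/eqP => E; have := le0x (pre 0); rewrite -E gen_root_le.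
  by rewrite has_root_pre.
apply/forallP => y; apply/forallP => z; apply/implyP => /eqP E.
have [le_y le_z] : y <= gen_root i /\ z <= gen_root i by rewrite E leUl leUr.
rewrite -implyNb; apply/implyP => ny; apply/eqP/le_anti.
rewrite le_z andbT gen_root_le; apply/negPn/negP => nz.
have below w : w <= gen_root i -> ~~ has_root w i -> w <= pre i.
  move=> le_w nwi; apply/has_root_le => k wk; rewrite has_root_pre ltn_neqAle.
  rewrite (gen_root_index (has_root_le _ _ le_w _ wk)) andbT.
  by apply: contraNneq nwi => /val_inj <-.
have : gen_root i <= pre i.
  rewrite E leUx !below //.
  apply: contra ny; rewrite -gen_root_le => ge_y; apply/eqP/le_anti.
  by rewrite ge_y le_y.
by rewrite gen_root_le has_root_pre ltnn.
Qed.

(** * Meet-irreducibles *)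

(* When [x] is meet-irreducible, with upper cover [x^*], this says that [i] is the first root
   that belongs to [x^*] but not to [x]. *)
Definition first_missing x i :=
  [&& ~~ has_root x i, [forall (y | x < y), has_root y i] &
      [forall k : 'I_m, (k < i)%N ==> [forall (y | x < y), has_root y k] ==> has_root x k]].

Lemma first_missing_irreducible x i : first_missing x i -> meet_irreducible x.
Proof.
case/and3P => nxi /forall_inP up _; apply/andP; split.
  by apply: contraNneq nxi => ->; apply: has_root_top.
apply/forallP => y; apply/forallP => z; apply/implyP => /eqP E.
have lt w : x <= w -> x != w -> has_root w i.
  by move=> le_xw ne_xw; apply: up; rewrite lt_neqAle ne_xw.
rewrite -implyNb; apply/implyP => ny; apply: contraNT nxi => nz.
rewrite /has_root {1}E I_meet; apply/andP; split; apply: lt => //;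
  by rewrite E ?leIl ?leIr.
Qed.

(** Take [x] with the most roots among the elements above [pre i] that miss root [i]: anything
    larger has root [i], and all earlier roots are in [x]. *)
Lemma first_missing_ex i : exists x, first_missing x i.
Proof.
pose P x := (pre i <= x) && ~~ has_root x i.
have P_pre : P (pre i) by rewrite /P lexx has_root_pre ltnn.
case: (arg_maxnP (fun x => #|has_root x|) P_pre) => x /andP[le_x nxi] max_x.
exists x; apply/and3P; split=> //.
  apply/forall_inP => y lt_xy; apply/negPn/negP => nyi.
  have /max_x : P y by rewrite /P nyi (le_trans le_x (ltW lt_xy)).
  rewrite /= leqNgt => /negP[]; apply: proper_card; rewrite properE; apply/andP; split.
    by apply/subsetP => k; apply: (has_root_le _ _ (ltW lt_xy)).
  apply/negP => /subsetP sub; have /(lt_le_trans lt_xy) : y <= x by apply/has_root_le.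
  by rewrite ltxx.
apply/forallP => k; apply/implyP => lt_ki; apply/implyP => _.
by apply: (has_root_le _ _ le_x); rewrite has_root_pre.
Qed.

(** If [y] is not below [x], the join of [x] and [y] has root [i], say [ac]. The roots [ab] with [b]
    in [D] and [bc] with [b] outside [D] precede [ac] and are forced by it, so [x] and [y] contain
    them, and [hull_semidistributive] puts [ac] in [x] or [y]. *)
Lemma first_missing_uniq x y i : first_missing x i -> first_missing y i -> x = y.
Proof.
suff le_yx x' y' : first_missing x' i -> first_missing y' i -> y' <= x'.
  by move=> mx my; apply/le_anti; rewrite !le_yx.
move: x' y' => {}x {}y mx my.
apply/negPn/negP => nyx.
have nxi : ~~ has_root x i by case/and3P: mx.
have nyi : ~~ has_root y i by case/and3P: my.
have lt_x : x < x `|` y.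
  by rewrite lt_neqAle leUl andbT; apply: contra nyx => /eqP->; apply: leUr.
have : has_root (x `|` y) i by case/and3P: mx => _ /forall_inP/(_ _ lt_x).
(* An earlier root forced by root [i] belongs to every element above [w], hence to [w]. *)
have low w b c : first_missing w i -> (ival b < ival c)%R -> (root_index D b c < i)%N ->
    (forall v, has_root v i -> I v b c) -> I w b c.
  case/and3P => _ /forall_inP up /forallP low bc; have [k -> E] := has_rootE bc.
  move=> lt_ki sub; rewrite E; apply: (implyP (implyP (low k) lt_ki)).
  by apply/forall_inP => v /up; rewrite -E; apply: sub.
have lt_i := root_lt i.
move/I_join => hull_i; suff : has_root x i || has_root y i.
  by rewrite (negPf nxi) (negPf nyi).
apply: (hull_semidistributive (I_aligned x) (I_aligned y) _ _ hull_i).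
- move=> b ab bc Db; have [] := root_index_dn D_opp ab bc Db.
  rewrite root_indexE => lt_b _.
  have sub v : has_root v i -> I v (root_at i).1 b.
    by have [_ _ _ dn] := I_aligned v; apply: dn.
  by apply/andP; split; apply: low.
- move=> b ab bc Db; have [] := root_index_up D_opp ab bc Db.
  rewrite root_indexE => lt_b _.
  have sub v : has_root v i -> I v b (root_at i).2.
    exact: (aligned_up D_opp (I_aligned v) ab bc Db).
  by apply/andP; split; apply: low.
Qed.

Lemma first_missing_inj x i k : first_missing x i -> first_missing x k -> i = k.
Proof.
move=> mi mk; apply/val_inj.
have le i' k' : first_missing x i' -> first_missing x k' -> (i' <= k')%N.
  move=> /and3P[_ _ /forallP low] /and3P[nk up _]; rewrite leqNgt.
  by apply: contra nk => lt_ki; apply: (implyP (implyP (low k') lt_ki)).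
by apply/anti_leq; rewrite !le.
Qed.

Lemma meet_irreducible_missing x : meet_irreducible x -> exists i, first_missing x i.
Proof.
move=> mi; pose P i := ~~ has_root x i && [forall (y | x < y), has_root y i].
have [i0 Pi0|noP] := pickP P.
  case: (arg_minnP val Pi0) => i /andP[nxi up] min_i; exists i; apply/and3P; split=> //.
  apply/forallP => k; apply/implyP => lt_ki; apply/implyP => up_k.
  apply: contraLR lt_ki => nxk; rewrite -leqNgt; apply: min_i.
  by rewrite /P nxk.
(* If every root common to all larger elements were in [x], then [x] would be their meet. *)
have E : x = \meet_(y | x < y) y.
  apply/le_anti/andP; split; first by apply/meetsP => y /ltW.
  apply/has_root_le => i xi; apply/negPn/negP => nxi.
  have /negP[] := noP i; rewrite /P nxi /=; apply/forall_inP => y lt_xy.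
  by apply: (has_root_le _ _ _ _ xi); apply: meets_inf.
by have [y lt_xy xy] := meet_irreducible_big mi E; rewrite xy ltxx in lt_xy.
Qed.

Lemma card_meet_irreducible : #|[set x : L | meet_irreducible x]| = m.
Proof.
pose f i := xchoose (first_missing_ex i).
have fP i : first_missing (f i) i := xchooseP (first_missing_ex i).
have -> : [set x : L | meet_irreducible x] = [set f i | i : 'I_m].
  apply/setP => x; rewrite inE; apply/idP/imsetP => [/meet_irreducible_missing[i xi]|[i _ ->]].
    by exists i; last exact: first_missing_uniq xi (fP i).
  exact: first_missing_irreducible (fP i).
by rewrite card_imset ?card_ord // => i k E; apply: first_missing_inj (fP i) _; rewrite E.
Qed.

Lemma aligned_lattice_trim : trim L.
Proof.
exists m; have [maxC cardC] := pre_maxchain; split; last exact: card_meet_irreducible.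
  exists [set pre i | i : 'I_m.+1]; split=> // _ /imsetP[i _ ->].
  exact: pre_left_modular.
by rewrite join_irreducibleE card_imset ?card_ord //; apply: gen_root_inj.
Qed.

End AlignedLattice.

(** * Avoiders *)

Section Avoiders.
Variables (n : nat) (G : orientation n).
Implicit Types (p q r : sperm n) (a b c : sgn n).

Local Notation D := (mem (setD_of G)).

Lemma setU_opp b : (b \in setU_of G) = (sopp b \in setD_of G).
Proof.
rewrite !inE; apply: eq_existsb => i; rewrite ivalN.
by case: (G i); rewrite eqr_oppLR ?opprK.
Qed.

Lemma setD_opp a b c : (ival a < ival b)%R -> (ival b < ival c)%R ->
  (sopp b \in setD_of G) = (b \notin setD_of G).
Proof.
move=> ab bc; have := ival_bound a; have := ival_bound c.
case: b ab bc => s k ab bc bound_c bound_a.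
have ivalE t : ival (t, k) = (if t then - k.+1%:Z else k.+1%:Z)%R by [].
(* Strictly between two values, [b] has absolute value below [n], so it belongs to an edge [j] of
   the diagram. *)
rewrite !ivalE in ab bc; have lt_k : (k < n.-1)%N by case: s ab bc; lia.
pose j := Ordinal lt_k.
have memD t : ((t, k) \in setD_of G) = t (+) G j.
  rewrite inE; apply/existsP/idP => [[i]|Dt].
    have [<-|ne_ij] := eqVneq i j.
      by case: t; case: (G i); rewrite /ival //=; lia.
    have /eqP ne : i != k :> nat by apply: contra ne_ij => /eqP E; apply/eqP/val_inj.
    by case: t; case: (G i); rewrite /ival //=; lia.
  by exists j; move: Dt; case: t; case: (G j); rewrite /ival //=.
by rewrite /sopp /= !memD; case: s {ab bc}; case: (G j).
Qed.

Lemma inv_rel_trans p : transitive (inv_rel p).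
Proof.
move=> b a c /andP[ab ba] /andP[bc cb]; rewrite /inv_rel /= (lt_trans ab bc) /=.
exact: precedes_trans cb ba.
Qed.

(** For values [a < b < c], the pattern [31\underline 2] is the order [c], [a], [b] with [b] in [D]:
    [ac] is inverted and [ab] is not. The pattern [\bar 231] is the order [b], [c], [a] with [b] in
    [U], the mirrored failure of alignment. *)
Lemma avoidersP p : p \in avoiders G <-> aligned D (inv_rel p).
Proof.
have pos a b : (ival a < ival b)%R = precedes p (p a) (p b).
  by rewrite /precedes !permK.
split=> [|al_p].
  rewrite inE => /andP[_ no312]; split=> [a b /andP[] //|a b||a b c ab bc Db ac].
  - by rewrite inv_opp.
  - exact: inv_rel_trans.
  apply: contraNT no312 => nab; move: nab; rewrite -precedes_ninv // => nab.
  apply/existsP; exists ((sperm_val p)^-1 c)%g; apply/existsP; exists ((sperm_val p)^-1 a)%g.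
  apply/existsP; exists ((sperm_val p)^-1 b)%g; rewrite !permKV ab bc.
  by case/andP: ac => _ ca; apply/and5P; split.
have [_ _ _ dn_p] := al_p.
rewrite inE; apply/andP; split; apply/negP => /existsP[a /existsP[b /existsP[c]]].
  rewrite (pos a b) (pos b c) => /and5P[ab bc ca lt_ab]; rewrite setU_opp (setD_opp ca lt_ab) => Da.
  have : inv_rel p (p c) (p b) by rewrite -precedes_inv // (lt_trans ca lt_ab).
  move/(aligned_up setD_opp al_p ca lt_ab Da)/andP=> [_ /(precedes_trans ab)].
  by rewrite precedes_irr.
rewrite (pos a b) (pos b c) => /and5P[ab bc lt_bc ca Dc].
have : inv_rel p (p b) (p a) by rewrite -precedes_inv // (lt_trans lt_bc ca).
move/(dn_p _ _ _ lt_bc ca Dc)/andP=> [_ /(precedes_trans bc)].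
by rewrite precedes_irr.
Qed.

Lemma avoider_onto (J : rel (sgn n)) : aligned D J ->
  exists2 p, p \in avoiders G & inv_rel p =2 J.
Proof.
move=> al_J; have [p Ip] := aligned_realize setD_opp al_J; exists p => //.
by apply/avoidersP; apply: aligned_eq al_J => a b; rewrite Ip.
Qed.

(** The intersection is a meet in the whole weak order, so a quotient map preserves it. *)
Lemma avoider_meet p q : p \in avoiders G -> q \in avoiders G ->
  exists2 r, r \in avoiders G & is_meet p q r.
Proof.
move=> /avoidersP al_p /avoidersP al_q.
have [r r_av Ir] := avoider_onto (aligned_cap al_p al_q); exists r => // u.
split=> [/weak_le_inv sub|[/weak_le_inv sub_p /weak_le_inv sub_q]].
  by split; apply/weak_le_inv => a b /sub; rewrite Ir => /andP[].
by apply/weak_le_inv => a b ab; rewrite Ir sub_p // sub_q.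
Qed.

Lemma avoider_join p q : p \in avoiders G -> q \in avoiders G ->
  exists2 r, r \in avoiders G &
    [/\ p <= r, q <= r & forall u, u \in avoiders G -> p <= u -> q <= u -> r <= u].
Proof.
move=> /avoidersP al_p /avoidersP al_q.
have [r r_av Ir] := avoider_onto (aligned_hull al_p al_q); exists r => //.
split=> [||u /avoidersP[_ _ tr_u _] /weak_le_inv sub_p /weak_le_inv sub_q].
- apply/weak_le_inv => a b ab; rewrite Ir; apply: (cup_hull al_p al_q).
  by rewrite /cup /= ab.
- apply/weak_le_inv => a b ab; rewrite Ir; apply: (cup_hull al_p al_q).
  by rewrite /cup /= ab orbT.
apply/weak_le_inv => a c; rewrite Ir => /andP[nac /connectP[s]].
elim: s a nac => [a /eqP nac _ /esym //|e s IHs a nac /= /andP[ae path_s] E].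
have {}ae : inv_rel u a e by case/orP: ae => [/sub_p|/sub_q].
have [<- //|nec] := eqVneq e c.
by apply: tr_u ae (IHs _ nec path_s E).
Qed.

Lemma avoiders_embedding_trim (d : Order.disp_t) (L : finTBLatticeType d) (g : L -> sperm n) :
    {mono g : x y / x <= y} -> (forall p, p \in avoiders G <-> exists x, g x = p) ->
  trim L.
Proof.
move=> mono_g im_g.
apply: (@aligned_lattice_trim n D setD_opp d L (fun x => inv_rel (g x))).
- by move=> x y; rewrite -mono_g; apply: weak_le_inv.
- by move=> x; apply/avoidersP/im_g; exists x.
- by move=> J /avoider_onto[p /im_g[x <-] Ip]; exists x.
Qed.

(** * The Cambrian quotient as the poset of avoiders *)

Section Quotient.
Variables (d : Order.disp_t) (L : finTBLatticeType d) (f : sperm n -> L).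
Hypothesis f_quot : cambrian_quotient G f.

(** An element of the fibre with the fewest elements below it is minimal there. *)
Lemma quotient_fibre x : exists p, (p \in avoiders G) && (f p == x).
Proof.
have [f_onto _ _ f_min] := f_quot; have [p0 /eqP fp0] := f_onto x.
case: (@arg_minnP _ p0 (fun p => f p == x) (fun p => #|[set r | r <= p]|) fp0).
move=> p /eqP fp min_p; exists p; rewrite fp eqxx andbT; apply/f_min => q fq le_qp.
apply/eqP; apply: contraT => ne_qp.
have := min_p q; rewrite fq fp eqxx => /(_ isT); rewrite leqNgt => /negP[].
apply: proper_card; apply/properP; split.
  by apply/subsetP => r; rewrite !inE => /le_trans; apply.
exists p; rewrite !inE ?lexx //; apply: contra ne_qp => le_pq.
by rewrite eq_le le_qp.
Qed.

(** The meet of [p] and [q] has the same image as [p], so by minimality of [p] in its fibre it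
    equals [p]. *)
Lemma quotient_min p q : p \in avoiders G -> q \in avoiders G -> f p <= f q -> p <= q.
Proof.
have [_ _ f_meet f_min] := f_quot => p_av q_av le_f.
have [r r_av r_meet] := avoider_meet p_av q_av.
have [le_rp le_rq] := (r_meet r).1 (lexx r).
have /f_min min_p := p_av.
by rewrite -(min_p r) //; rewrite (f_meet _ _ _ r_meet); apply/eqP; rewrite -leEmeet.
Qed.

Lemma quotient_trim : trim L.
Proof.
have [_ f_join _ _] := f_quot.
pose g x := xchoose (quotient_fibre x).
have gP x : (g x \in avoiders G) && (f (g x) == x) := xchooseP (quotient_fibre x).
have g_av x : g x \in avoiders G by case/andP: (gP x).
have gK x : f (g x) = x by case/andP: (gP x) => _ /eqP.
apply: (@avoiders_embedding_trim d L g) => [x y|p].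
  apply/idP/idP => [le_g|le_xy]; last by apply: quotient_min; rewrite ?gK.
  (* Preservation of joins makes [f] monotone. *)
  have /f_join : is_join (g x) (g y) (g y).
    by move=> u; split=> [le_u|[]//]; split=> //; apply: le_trans le_u.
  by rewrite !gK => ->; apply: leUl.
split=> [p_av|[x <-] //]; exists (f p); apply/le_anti.
by rewrite !quotient_min ?gK.
Qed.

End Quotient.

End Avoiders.

(** * The lattice of avoiders *)

Definition avoider (n : nat) (G : orientation n) := {p : sperm n | p \in avoiders G}.

Section AvoiderLattice.
Variables (n : nat) (G : orientation n).
Implicit Types x y z : avoider G.

HB.instance Definition _ := Finite.on (avoider G).

Let avoider_le x y := val x <= val y.

Fact avoider_le_anti : antisymmetric avoider_le.
Proof. by move=> x y /le_anti/val_inj. Qed.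

HB.instance Definition _ := Order.Le_isPOrder.Build weak_display (avoider G)
  (fun x => lexx (val x)) avoider_le_anti (fun y x z => @le_trans _ _ (val y) (val x) (val z)).

Fact avoider_meet_ex x y : exists w : avoider G, [forall z, (z <= w) == (z <= x) && (z <= y)].
Proof.
have [r r_av r_meet] := avoider_meet (valP x) (valP y).
exists (Sub r r_av); apply/forallP => z; apply/eqP; apply/idP/andP => [/r_meet //|].
exact: (r_meet _).2.
Qed.

Fact avoider_join_ex x y : exists w : avoider G, [forall z, (w <= z) == (x <= z) && (y <= z)].
Proof.
have [r r_av [le_xr le_yr min_r]] := avoider_join (valP x) (valP y).
exists (Sub r r_av); apply/forallP => z; apply/eqP; apply/idP/andP => [le_rz|[le_xz le_yz]].
  by split; [apply: le_trans le_xr le_rz | apply: le_trans le_yr le_rz].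
exact: min_r (valP z) le_xz le_yz.
Qed.

HB.instance Definition _ := Order.POrder_MeetJoin_isLattice.Build weak_display (avoider G)
  (fun x y z => eqP (forallP (xchooseP (avoider_meet_ex y z)) x))
  (fun x y z => eqP (forallP (xchooseP (avoider_join_ex x y)) z)).

Fact avoider_bottom_ex : exists w : avoider G, [forall z, w <= z].
Proof.
have [|r r_av Ir] := @avoider_onto n G (fun _ _ => false); first by split.
exists (Sub r r_av); apply/forallP => z; apply/weak_le_inv => a b /=; by rewrite Ir.
Qed.

Fact avoider_top_ex : exists w : avoider G, [forall z, z <= w].
Proof.
have [|r r_av Ir] := @avoider_onto n G (fun a b => (ival a < ival b)%R).
  by split=> // [a b|b a c]; [rewrite !ivalN ltrN2 | apply: lt_trans].
exists (Sub r r_av); apply/forallP => z; apply/weak_le_inv => a b /=.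
by rewrite Ir => /andP[].
Qed.

HB.instance Definition _ := Order.hasBottom.Build weak_display (avoider G)
  (forallP (xchooseP avoider_bottom_ex)).
HB.instance Definition _ := Order.hasTop.Build weak_display (avoider G)
  (forallP (xchooseP avoider_top_ex)).

Lemma avoiders_trim : is_trim_lattice (avoiders G).
Proof.
have im_val p : p \in avoiders G <-> exists x : avoider G, val x = p.
  by split=> [p_av|[x <-]]; [exists (Sub p p_av) | apply: valP].
exists weak_display, (avoider G : finTBLatticeType weak_display), val; split=> //.
exact: (@avoiders_embedding_trim n G _ (avoider G : finTBLatticeType weak_display) val).
Qed.

End AvoiderLattice.

Theorem theorem8 (n : nat) (hn : (2 <= n)%N) (G : orientation n) :
  (forall (d : Order.disp_t) (L : finTBLatticeType d) (f : sperm n -> L),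
      cambrian_quotient G f -> trim L) /\
  is_trim_lattice (avoiders G).
Proof.
by split=> [d L f|]; [apply: quotient_trim | apply: avoiders_trim].
Qed.
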